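(* Let $T_1:\mathcal{H}_1\to\mathcal{H}_1'$ and $T_2:\mathcal{H}_2\to\mathcal{H}_2'$ be bounded linear operators between complex Hilbert spaces, with dimension spectral measures $\mathcal{D}_1$ and $\mathcal{D}_2$ respectively. If $T_1$ and $T_2$ are topologically equivalent, then $\mathcal{D}_1$ and $\mathcal{D}_2$ are equivalent, i.e. there exists a constant $K\ge 1$ such that for all $\mu\ge 0$ $$\mathcal{D}_1([0,\mu])\le\mathcal{D}_2([0,K\mu]),\qquad \mathcal{D}_2([0,\mu])\le\mathcal{D}_1([0,K\mu]),$$ and for all $\mu>\mu'\ge 0$ $$\mathcal{D}_1(]\mu',\mu])\le\mathcal{D}_2(]\mu'/K,K\mu]),\qquad \mathcal{D}_2(]\mu',\mu])\le\mathcal{D}_1(]\mu'/K,K\mu]).$$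
   Context: Two bounded operators $T_1:X_1\to Y_1$ and $T_2:X_2\to Y_2$ between Banach spaces are topologically equivalent if there exist isomorphisms onto (bounded linear bijections with bounded inverse) $U:X_1\to X_2$ and $V:Y_1\to Y_2$ such that $T_2=VT_1U^{-1}$. For a bounded linear operator $T:\mathcal{H}\to\mathcal{H}'$ between complex Hilbert spaces, let $A=\sqrt{T^\star T}$ be the positive semi-definite square root of $T^\star T$, and let $\mathcal{E}$ be its spectral measure, a projection-valued measure on the Borel subsets of $[0,\infty[$ with $A=\int_{[0,\infty[}\lambda\,d\mathcal{E}(\lambda)$. The dimension spectral measure of $T$ is the cardinal-number-valued ($\sigma$-additive) measure $\mathcal{D}(S)=\dim\mathcal{E}(S)\mathcal{H}$ on Borel sets $S\subset[0,\infty[$, where $\dim$ is the Hilbert dimension (the cardinality of an orthonormal basis). Intervals are written $]a,b]=\{x: a<x\le b\}$; inequalities are between cardinal numbers. *)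

(* Defs.v *)
From HB Require Import structures.
From mathcomp Require Import all_boot all_order all_algebra.
From mathcomp Require Import complex.
From mathcomp Require Import all_classical all_reals all_analysis.

Set Implicit Arguments.
Unset Strict Implicit.
Unset Printing Implicit Defensive.

Import Order.TTheory GRing.Theory Num.Theory.
Import numFieldNormedType.Exports.

Local Open Scope classical_set_scope.
Local Open Scope ring_scope.
Local Open Scope complex_scope.
Local Open Scope card_scope.

(* Complex Hilbert spaces: the inner product is linear in its first argument
   and conjugate-linear in the second one. *)
HB.mixin Record CompleteNormedModule_isHilbert (R : realType) H
    & CompleteNormedModule R[i] H := {
  inner : {dot H for @Num.conj R[i]} ;
  inner_normE : forall x : H, inner x x = `|x| ^+ 2
}.

#[short(type="hilbertType")]
HB.structure Definition Hilbert (R : realType) :=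
  {H of CompleteNormedModule R[i] H & CompleteNormedModule_isHilbert R H}.

Section TopologicalEquivalence.
Variable K : numFieldType.

Definition mutually_inverse_isomorphisms (X Y : completeNormedModType K)
    (U : {linear X -> Y}) (Uinv : {linear Y -> X}) : Prop :=
  [/\ continuous U, continuous Uinv, cancel U Uinv & cancel Uinv U].

Definition topologically_equivalent (X1 Y1 X2 Y2 : completeNormedModType K)
    (T1 : {linear X1 -> Y1}) (T2 : {linear X2 -> Y2}) : Prop :=
  exists (U : {linear X1 -> X2}) (Uinv : {linear X2 -> X1})
         (V : {linear Y1 -> Y2}) (Vinv : {linear Y2 -> Y1}),
    [/\ mutually_inverse_isomorphisms U Uinv,
        mutually_inverse_isomorphisms V Vinv &
        forall x, T2 x = V (T1 (Uinv x))].

End TopologicalEquivalence.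

Section Operators.
Variable R : realType.

Definition adjoint (H H' : hilbertType R)
    (T : {linear H -> H'}) (Ts : {linear H' -> H}) : Prop :=
  forall x y, inner (T x) y = inner x (Ts y).

(* The order of [R[i]] makes [0 <= z] mean that [z] is real and nonnegative. *)
Definition positive_semidefinite (H : hilbertType R) (A : {linear H -> H}) :
  Prop := forall x, 0 <= inner (A x) x.

Definition is_sqrt_adjoint_comp (H H' : hilbertType R)
    (T : {linear H -> H'}) (A : {linear H -> H}) : Prop :=
  [/\ continuous A, positive_semidefinite A &
      exists Ts : {linear H' -> H},
        [/\ continuous Ts, adjoint T Ts & forall x, A (A x) = Ts (T x)]].

Definition orthogonal_projection (H : hilbertType R) (P : {linear H -> H}) :
  Prop := (forall x, P (P x) = P x) /\ adjoint P P.

End Operators.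

Section SpectralMeasures.
Variable R : realType.

Definition half_line : set R := `[0, +oo[%classic.

Definition borel_half_line (S : set R) : Prop :=
  measurable S /\ S `<=` half_line.

(* The values of [E] outside of the Borel subsets of the half-line are
   irrelevant. Countable additivity is in the strong operator topology. *)
Record projection_valued_measure (H : hilbertType R)
    (E : set R -> {linear H -> H}) : Prop := {
  pvm_projection : forall S, borel_half_line S -> orthogonal_projection (E S) ;
  pvm_set0 : forall x, E set0 x = 0 ;
  pvm_half_line : forall x, E half_line x = x ;
  pvm_setI : forall S S', borel_half_line S -> borel_half_line S' ->
    forall x, E (S `&` S') x = E S (E S' x) ;
  pvm_sigma_additive : forall F : (set R)^nat,
    (forall n, borel_half_line (F n)) -> trivIset setT F ->
    forall x, series (fun n => E (F n) x) @ \oo --> E (\bigcup_n F n) x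
}.

(* The finite measure <E(.)x, x>, extended by 0 outside of the half-line. *)
Definition scalar_measure (H : hilbertType R) (E : set R -> {linear H -> H})
    (x : H) (S : set R) : \bar R :=
  (complex.Re (inner (E (S `&` half_line) x) x))%:E.

(* A = \int_[0,+oo[ lambda dE(lambda) in the weak sense:
   <A x, x> = \int_[0,+oo[ lambda d<E(lambda)x, x> for every x, which determines
   <A x, y> for all x and y by polarization. *)
Definition is_spectral_integral (H : hilbertType R)
    (E : set R -> {linear H -> H}) (A : {linear H -> H}) : Prop :=
  forall x,
    (scalar_measure E x).-integrable half_line (fun l : R => l%:E) /\
    inner (A x) x =
      (fine (\int[scalar_measure E x]_(l in half_line) l%:E)%E)%:C.

Definition spectral_measure_of (H : hilbertType R) (A : {linear H -> H})
    (E : set R -> {linear H -> H}) : Prop :=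
  projection_valued_measure E /\ is_spectral_integral E A.

(* [E] is the spectral measure of the square root of the positive operator
   T^* T. *)
Definition abs_spectral_measure (H H' : hilbertType R) (T : {linear H -> H'})
    (E : set R -> {linear H -> H}) : Prop :=
  exists A : {linear H -> H},
    is_sqrt_adjoint_comp T A /\ spectral_measure_of A E.

End SpectralMeasures.

Section HilbertDimension.
Variable R : realType.

Definition orthonormal_set (H : hilbertType R) (B : set H) : Prop :=
  (forall b, B b -> inner b b = 1) /\
  (forall b c, B b -> B c -> b <> c -> inner b c = 0).

(* Orthonormal bases are the maximal orthonormal subsets. *)
Definition orthonormal_basis (H : hilbertType R) (V B : set H) : Prop :=
  [/\ orthonormal_set B, B `<=` V &
      forall C, orthonormal_set C -> C `<=` V -> B `<=` C -> C = B].

(* Cardinal numbers are represented by sets and compared by [#<=]; the Hilbert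
   dimension of V is represented by some orthonormal basis of V. *)
Definition hilbert_dim (H : hilbertType R) (V : set H) : set H :=
  xget set0 [set B | orthonormal_basis V B].

Lemma orthonormal_basis_exists (H : hilbertType R) (V : set H) :
  exists B, orthonormal_basis V B.
Proof.
have [F Fon Ftot|B [[Bon BV] Bmax]] :=
    @Zorn_bigcup H [set B | orthonormal_set B /\ B `<=` V].
  split; last by move=> b [B /Fon[_ BV] Bb]; exact: BV.
  split=> [b [B /Fon[[B1 _] _] Bb]|b c [B FB Bb] [C FC Cc]]; first exact: B1.
  have [BC|CB] := Ftot _ _ FB FC.
    by have [[_ C0] _] := Fon _ FC; apply: C0 => //; exact: BC.
  by have [[_ B0] _] := Fon _ FB; apply: B0 => //; exact: CB.
exists B; split=> // C Con CV BC; apply: contrapT => CB.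
apply: (Bmax C) => //; split=> // CB'; apply: CB.
by apply/seteqP; split.
Qed.

Lemma hilbert_dimP (H : hilbertType R) (V : set H) :
  orthonormal_basis V (hilbert_dim V).
Proof.
by have [B BV] := orthonormal_basis_exists V; exact: (xgetPex set0 (ex_intro _ B BV)).
Qed.

Definition dim_measure (H : hilbertType R) (E : set R -> {linear H -> H})
    (S : set R) : set H :=
  hilbert_dim (range (E S)).

Definition equivalent_dim_measures (T1 T2 : Type)
    (D1 : set R -> set T1) (D2 : set R -> set T2) : Prop :=
  exists2 K : R, 1 <= K &
    (forall mu : R, 0 <= mu ->
       D1 `[0, mu]%classic #<= D2 `[0, K * mu]%classic /\
       D2 `[0, mu]%classic #<= D1 `[0, K * mu]%classic) /\
    (forall mu' mu : R, 0 <= mu' -> mu' < mu ->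
       D1 `]mu', mu]%classic #<= D2 `]mu' / K, K * mu]%classic /\
       D2 `]mu', mu]%classic #<= D1 `]mu' / K, K * mu]%classic).

End HilbertDimension.

(* Main.v *)
Require Import Defs.
From HB Require Import structures.
From mathcomp Require Import all_boot all_order all_algebra.
From mathcomp Require Import complex ring lra.
From mathcomp Require Import all_classical all_reals all_analysis measurable_realfun.

(* Let T2 U = V T1 with U, V invertible. Vectors of E([0, mu]) satisfy
   |T x| <= mu |x| and nonzero vectors of E(]mu, +oo[) satisfy |T x| > mu |x|.
   For K large these bounds make the bounded operator E2(S') U injective on the
   range of E1(S), both for S = [0, mu], S' = [0, K mu] and for
   S = ]mu', mu], S' = ]mu'/K, K mu]: in the second case, if z in the range of
   E1(S) is killed, then U z = g + b with g in E2([0, mu'/K]) and b in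
   E2(]K mu, +oo[); U^-1 b is small because T2 b is, E1(S) U^-1 g is small
   because T1 U^-1 g is, and the two sum up to z under E1(S).

   A bounded operator L that is injective on a subspace containing an
   orthonormal set B and takes values in a subspace with orthonormal basis C
   gives #B <= #C: if C is finite this is linear algebra; otherwise B is covered
   by the sets {b | <L b, c> <> 0}, c in C, which are countable by Bessel's
   inequality. *)

Set Implicit Arguments.
Unset Strict Implicit.
Unset Printing Implicit Defensive.

Import Order.TTheory GRing.Theory Num.Theory.
Import numFieldNormedType.Exports.

Local Open Scope classical_set_scope.
Local Open Scope ring_scope.
Local Open Scope card_scope.

(** * The real inner product *)

Section RealInnerProduct.
Variables (R : realType).
Implicit Types (H : hilbertType R).

Definition re_inner H (x y : H) : R := complex.Re (inner x y).
Definition sqnorm H (x : H) : R := re_inner x x.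

Lemma innerC H (x y : H) : inner y x = Num.conj (inner x y).
Proof. by rewrite (hermC inner) expr0 mul1r. Qed.

Lemma re_innerC H (x y : H) : re_inner x y = re_inner y x.
Proof. by rewrite /re_inner (innerC y x); case: (inner y x). Qed.

Lemma re_inner0l H (z : H) : re_inner 0 z = 0.
Proof. by rewrite /re_inner linear0l. Qed.

Lemma re_innerDl H (x y z : H) : re_inner (x + y) z = re_inner x z + re_inner y z.
Proof. by rewrite /re_inner linearDl raddfD. Qed.

Lemma re_innerDr H (x y z : H) : re_inner z (x + y) = re_inner z x + re_inner z y.
Proof. by rewrite !(re_innerC z) re_innerDl. Qed.

Lemma re_innerNl H (x z : H) : re_inner (- x) z = - re_inner x z.
Proof. by rewrite /re_inner linearNl raddfN. Qed.

Lemma re_innerNr H (x z : H) : re_inner z (- x) = - re_inner z x.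
Proof. by rewrite !(re_innerC z) re_innerNl. Qed.

Lemma re_innerZl H a (x z : H) : re_inner (a%:C%C *: x) z = a * re_inner x z.
Proof.
rewrite /re_inner linearZl_LR /=.
by case: (inner x z) => u v /=; rewrite mul0r subr0.
Qed.

Lemma re_innerZr H a (x z : H) : re_inner x (a%:C%C *: z) = a * re_inner x z.
Proof. by rewrite re_innerC re_innerZl re_innerC. Qed.

Lemma inner_sqnorm H (x : H) : inner x x = (sqnorm x)%:C%C.
Proof.
have : inner x x \is Num.real by rewrite inner_normE rpredX// normr_real.
rewrite /sqnorm /re_inner; case: (inner x x) => u v /= /complex_realP[k [-> ->]].
by [].
Qed.

Lemma sqnorm_ge0 H (x : H) : 0 <= sqnorm x.
Proof. by rewrite -lecR -inner_sqnorm inner_normE exprn_ge0. Qed.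

Lemma sqnormE H (x : H) : (sqnorm x)%:C%C = `|x| ^+ 2.
Proof. by rewrite -inner_sqnorm inner_normE. Qed.

Lemma sqnorm_eq0 H (x : H) : sqnorm x = 0 -> x = 0.
Proof.
move=> /(congr1 (fun a => a%:C%C)); rewrite sqnormE => /eqP.
by rewrite sqrf_eq0 normr_eq0 => /eqP.
Qed.

Lemma sqnormD H (x y : H) : sqnorm (x + y) = sqnorm x + sqnorm y + 2 * re_inner x y.
Proof.
rewrite /sqnorm !re_innerDl !(re_innerC _ (x + y)) !re_innerDl (re_innerC y x).
ring.
Qed.

Lemma sqnormZ H a (x : H) : sqnorm (a%:C%C *: x) = a ^+ 2 * sqnorm x.
Proof. rewrite /sqnorm re_innerZl re_innerZr. ring. Qed.

Lemma sqnormD_le H (x y : H) : sqnorm (x + y) <= 2 * (sqnorm x + sqnorm y).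
Proof.
have := sqnorm_ge0 (x - y); rewrite !sqnormD re_innerNr.
rewrite {2}/sqnorm re_innerNl re_innerNr opprK -/(sqnorm _); lra.
Qed.

Lemma cauchy_schwarz H (x y : H) : re_inner x y ^+ 2 <= sqnorm x * sqnorm y.
Proof.
have [y0|yn0] := eqVneq (sqnorm y) 0.
  by rewrite (sqnorm_eq0 y0) /sqnorm re_innerC re_inner0l; lra.
have yp : 0 < sqnorm y by rewrite lt_def yn0 sqnorm_ge0.
(* The squared norm of this vector is [sqnorm y] times the difference of the two sides. *)
have := sqnorm_ge0 ((sqnorm y)%:C%C *: x + (- re_inner x y)%:C%C *: y).
rewrite sqnormD !sqnormZ re_innerZl re_innerZr => h.
rewrite -(ler_pM2l yp). nra.
Qed.

Lemma linear_sqnorm_bounded H H' (U : {linear H -> H'}) : continuous U ->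
  exists2 k : R, 0 <= k & forall x, sqnorm (U x) <= k * sqnorm x.
Proof.
move=> /linear_bounded_continuous/linear_boundedP.
move=> /pinfty_ex_gt0 [r r0 Bf].
(* Norms take values in [R[i]]; a positive bound is real and so descends to [R]. *)
have [s rE] : exists s, r = s%:C%C.
  by apply/complex_realP; rewrite gtr0_real.
exists (s ^+ 2); first exact: sqr_ge0.
move=> x; rewrite -lecR rmorphM rmorphXn /= !sqnormE -rE -exprMn.
by rewrite lerXn2r ?nnegrE ?mulr_ge0 ?(ltW r0).
Qed.

End RealInnerProduct.

(** * Cardinality of orthonormal sets *)

Lemma card_le_inj (T U : Type) (A : set T) (B : set U) (f : T -> U) :
  (forall x, A x -> B (f x)) ->
  (forall x y, A x -> A y -> f x = f y -> x = y) -> A #<= B.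
Proof.
move=> fB finj; have /injfunPex[g] : exists2 f : T -> U, set_fun A B f & set_inj A f.
  by exists f => // x y /set_mem Ax /set_mem Ay; exact: finj.
exact: inj_card_le.
Qed.

Lemma card_le_injP (T : Type) (U : pointedType) (A : set T) (B : set U) :
  A #<= B -> exists2 f : T -> U, (forall x, A x -> B (f x)) &
    (forall x y, A x -> A y -> f x = f y -> x = y).
Proof.
move=> /pcard_leP/injfunPex[f fB finj]; exists f => // x y Ax Ay.
by apply: finj; exact: mem_set.
Qed.

(** The second clause is injectivity of [(e, n) |-> e n] on [F] times the naturals: no sequence
    repeats a term, and different sequences have disjoint ranges. *)
Definition disjoint_sequences (T : Type) (C : set T) (F : set (nat -> T)) : Prop :=
  (forall e n, F e -> C (e n)) /\
  (forall e e' n n', F e -> F e' -> e n = e' n' -> e = e' /\ n = n').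

(** Zorn's lemma: an infinite remainder would contain an injective sequence, which could be added to
    a maximal family. *)
Lemma maximal_disjoint_sequences (T : pointedType) (C : set T) :
  exists2 F, disjoint_sequences C F &
    finite_set (C `\` [set t | exists2 e, F e & exists n, e n = t]).
Proof.
have [G GP Gtot|F [[FC Finj] Fmax]] := @Zorn_bigcup _ (disjoint_sequences C).
  split=> [e n [X GX Xe]|e e' n n' [X GX Xe] [Y GY Ye']].
    by have [+ _] := GP _ GX; exact.
  have [XY|YX] := Gtot _ _ GX GY.
    by have [_ +] := GP _ GY; apply => //; exact: XY.
  by have [_ +] := GP _ GX; apply => //; exact: YX.
exists F => //; apply: contrapT => /infiniteP.
move=> /card_le_injP[e eC einj].
have eNF n : ~ exists2 e', F e' & exists n', e' n' = e n by have [] := eC n I.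
apply: (Fmax (F `|` [set e])).
  split; first by move=> x Fx; left.
  by move=> /(_ e (or_intror erefl)) Fe; apply: (eNF 0); exists e => //; exists 0.
split=> [e' n [/FC//|->]|e' e'' n n' [Fe'|->] [Fe''|->]].
- by have [] := eC n I.
- exact: Finj.
- by move=> E; exfalso; apply: (eNF n'); exists e' => //; exists n.
- by move=> E; exfalso; apply: (eNF n); exists e'' => //; exists n'.
- by move=> /einj ->.
Qed.

(* A maximal family of disjoint sequences exhausts C up to finitely many points;
   these are inserted at the odd indices of one of the sequences. *)
Lemma card_le_setX_nat (T : pointedType) (C : set T) :
  infinite_set C -> C `*` [set: nat] #<= C.
Proof.
move=> Cinf; have [F [FC Finj]] := maximal_disjoint_sequences C.
set D := C `\` _ => Dfin; have /countable_injP[r rinj] := finite_set_countable Dfin.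
have [e0 Fe0] : exists e0, F e0.
  apply: contrapT => /forallNP F0; apply: Cinf; apply: sub_finite_set Dfin.
  by move=> t Ct; split=> // -[e /F0].
(* [i t] is an address of [t], a sequence and an index: even if [t] is a term of that sequence, odd
   and computed from [r] if [t] is left over. The parity separates the two cases, so [t] can be
   recovered. *)
have /choice[i iP] : forall t, exists en : (nat -> T) * nat, C t -> F en.1 /\
    ((en.1 en.2./2 = t /\ ~~ odd en.2) \/
     [/\ en = (e0, (r t).*2.+1) & D t]).
  move=> t; have [Ct|NCt] := pselect (C t); last by exists (e0, 0).
  have [[e Fe [n en]]|NFt] := pselect (exists2 e, F e & exists n, e n = t).
    by exists (e, n.*2) => _ /=; split=> //; left; rewrite doubleK odd_double.
  by exists (e0, (r t).*2.+1) => _; split=> //; right.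
have [pr prinj] : exists pr : nat * nat -> nat, injective pr.
  by exists pickle; exact: (pcan_inj pickleK).
(* Pairing the index of [t] with [m] gives a new position in the same sequence, so each sequence
   absorbs countably many copies of the points addressed in it. *)
apply: (card_le_inj (f := fun p => (i p.1).1 (pr ((i p.1).2, p.2)))).
  by move=> [t m] /= [Ct _]; apply: FC; have [] := iP _ Ct.
move=> [t m] [t' m'] /= [Ct _] [Ct' _].
have [Fi it] := iP _ Ct; have [Fi' it'] := iP _ Ct'.
move=> /(Finj _ _ _ _ Fi Fi')[ie /prinj[ine ->]]; congr (_, _).
case: it => [[it ot]|[it Dt]]; case: it' => [[it' ot']|[it' Dt']].
- by rewrite -it -it' ie ine.
- by move: ot; rewrite ine it' /= odd_double.
- by move: ot'; rewrite -ine it /= odd_double.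
- apply: rinj; [exact: mem_set..|].
  by move: ine; rewrite it it' /= => -[] /double_inj.
Qed.

(** A point [b] is determined by some [c] with [b] in [S c] and its number in an enumeration of
    [S c]; this embeds [B] into [C] times the naturals. *)
Lemma card_le_countable_cover (T : Type) (U : pointedType) (B : set T) (C : set U)
    (S : U -> set T) :
  infinite_set C -> (forall c, C c -> countable (S c)) ->
  B `<=` \bigcup_(c in C) S c -> B #<= C.
Proof.
move=> Cinf Scount BS; apply: card_le_trans (card_le_setX_nat Cinf).
have /choice[f fP] : forall b, exists c, B b -> C c /\ S c b.
  move=> b; have [Bb|NBb] := pselect (B b); last by exists point.
  by have [c Cc Sb] := BS _ Bb; exists c.
have /choice[g gP] : forall c, exists g : T -> nat, C c ->
    {in S c &, injective g}.
  move=> c; have [Cc|NCc] := pselect (C c); last by exists (fun=> 0).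
  by have /countable_injP[g ginj] := Scount _ Cc; exists g.
apply: (card_le_inj (f := fun b => (f b, g (f b) b))).
  by move=> b /fP[].
move=> b b' Bb Bb' [ff]; have [Cb Sb] := fP _ Bb; have [_ Sb'] := fP _ Bb'.
rewrite -ff; apply: (gP _ Cb); apply: mem_set => //.
by rewrite ff.
Qed.

(** * Bessel's inequality and orthonormal sets under a bounded operator *)

Section OrthonormalSets.
Variables (R : realType) (H H' : hilbertType R).
Variables (L : {linear H -> H'}) (k : R).
Hypothesis k0 : 0 <= k.
Hypothesis Lk : forall x, sqnorm (L x) <= k * sqnorm x.

(** The squared modulus, taken in [R] rather than in [R[i]]. *)
Definition sqabs (a : R[i]) : R := complex.Re (a * Num.conj a).

Lemma sqabsE (a : R[i]) : a * Num.conj a = (sqabs a)%:C%C.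
Proof.
rewrite /sqabs; case: a => x y; apply/eqP; rewrite eq_complex/= eqxx.
by apply/eqP; ring.
Qed.

Lemma sqabs_ge0 (a : R[i]) : 0 <= sqabs a.
Proof. by rewrite -lecR -sqabsE mul_conjC_ge0. Qed.

Lemma sqabs_eq0 (a : R[i]) : sqabs a = 0 -> a = 0.
Proof.
move=> a0; have /eqP := sqabsE a.
by rewrite a0 mul_conjC_eq0 => /eqP.
Qed.

Lemma inner_combination (N : nat) (g : nat -> H) (a : 'I_N -> R[i]) (j : 'I_N) :
  (forall i j, (i < N)%N -> (j < N)%N -> inner (g i) (g j) = (i == j)%:R) ->
  inner (\sum_(i < N) a i *: g i) (g j) = a j.
Proof.
move=> gorth; rewrite linear_sumlz (bigD1 j)//= linearZl_LR/= gorth// eqxx mulr1.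
rewrite big1 ?addr0// => i /negPf ij.
by rewrite linearZl_LR/= gorth// -[_ == _]/(i == j) ij mulr0.
Qed.

(** Bessel's inequality for the functional [<L ., c>], with no adjoint of [L]: the test vector [v]
    satisfies [<L v, c> = |v|^2 = s], so Cauchy-Schwarz gives [s^2 <= |L v|^2 <= k s]. *)
Lemma bessel_bound (N : nat) (g : nat -> H) (c : H') :
  (forall i j, (i < N)%N -> (j < N)%N -> inner (g i) (g j) = (i == j)%:R) ->
  sqnorm c = 1 -> \sum_(i < N) sqabs (inner (L (g i)) c) <= k.
Proof.
move=> gorth c1; set s := \sum_(i < N) _.
pose v := \sum_(i < N) Num.conj (inner (L (g i)) c) *: g i.
have Lv : inner (L v) c = s%:C%C.
  rewrite linear_sum linear_sumlz rmorph_sum; apply: eq_bigr => i _.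
  by rewrite linearZ/= linearZl_LR/= mulrC; exact: sqabsE.
have vs : sqnorm v = s.
  apply: (@complexI R); rewrite -inner_sqnorm {2}/v linear_sumr rmorph_sum.
  apply: eq_bigr => i _; rewrite linearZr_LR/= inner_combination//.
  by rewrite -sqabsE conjCK.
have := cauchy_schwarz (L v) c.
rewrite c1 mulr1 {1}/re_inner Lv /= => sle.
have := le_trans sle (Lk v); rewrite vs.
have : 0 <= s by apply: sumr_ge0 => i _; exact: sqabs_ge0.
rewrite le0r => /predU1P[->//|s0]; by rewrite expr2 ler_pM2r.
Qed.

Lemma orthonormal_sequence (B : set H) (N : nat) (g : nat -> H) :
  orthonormal_set B -> (forall i, (i < N)%N -> B (g i)) ->
  (forall i j, (i < N)%N -> (j < N)%N -> g i = g j -> i = j) ->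
  forall i j, (i < N)%N -> (j < N)%N -> inner (g i) (g j) = (i == j)%:R.
Proof.
move=> [B1 B0] gB ginj i j iN jN; have [->|/eqP ij] := eqVneq i j.
  by apply: B1; exact: gB.
by apply: B0; [exact: gB|exact: gB|move=> /ginj; auto].
Qed.

(** The support is the union of the sets [S m] where the squared coefficient is at least [1/(m+1)],
    and Bessel's inequality makes each of these finite. *)
Lemma orthonormal_countable_support (B : set H) (c : H') :
  orthonormal_set B -> sqnorm c = 1 ->
  countable [set b | B b /\ inner (L b) c != 0].
Proof.
move=> Bon c1.
pose S m := [set b | B b /\ m.+1%:R^-1 <= sqabs (inner (L b) c)].
apply: (@sub_countable _ _ _ (\bigcup_(m in [set: nat]) S m)).
  apply: subset_card_le => b [Bb Lb].
  have Lb0 : 0 < sqabs (inner (L b) c).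
    rewrite lt_def sqabs_ge0 andbT; apply: contraNneq Lb => /sqabs_eq0 ->.
    exact: eqxx.
  exists (Num.truncn (sqabs (inner (L b) c))^-1) => //; split=> //.
  by rewrite invf_ple ?posrE// ltW// truncnS_gt.
apply: bigcup_countable => [|m _]; first exact: countableP.
apply: finite_set_countable; apply: contrapT => /infiniteP /card_le_injP[g gS ginj].
(* The least natural number above [k (m+1)]: [N] coefficients of size at least [1/(m+1)] sum to more
   than [k]. *)
pose N := (Num.truncn (k * m.+1%:R)).+1.
have gorth : forall i j, (i < N)%N -> (j < N)%N -> inner (g i) (g j) = (i == j)%:R.
  apply: (orthonormal_sequence Bon) => [i _|i j _ _ gij]; first by have [] := gS i I.
  exact: ginj.
have := bessel_bound gorth c1; apply/negP; rewrite -ltNge.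
apply: (@lt_le_trans _ _ (\sum_(i < N) m.+1%:R^-1)); last first.
  by apply: ler_sum => i _; have [] := gS i I.
by rewrite sumr_const card_ord -(mulr_natl _ N) ltr_pdivlMr// truncnS_gt.
Qed.

Variable P : {linear H -> H}.

(** An [(n+1)] by [n] matrix has a nonzero left kernel vector [u]. The combination of the [g i] with
    coefficients [u] lies in the range of [P] and is killed by all [n] functionals, so it vanishes,
    against orthonormality. *)
Lemma orthonormal_finite_le (B : set H) (n : nat) (c : nat -> H') :
  orthonormal_set B -> B `<=` range P ->
  (forall x, (forall j, (j < n)%N -> inner (L (P x)) (c j) = 0) -> P x = 0) ->
  ~ (`I_(n.+1) #<= B).
Proof.
move=> Bon BP Pinj /card_le_injP[g gB ginj].
have gorth := orthonormal_sequence Bon gB ginj.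
pose A := (\matrix_(i < n.+1, j < n) inner (L (g i)) (c j))%R.
have /rowV0Pn[u /sub_kermxP uA u0] : kermx A != 0.
  rewrite -mxrank_eq0 mxrank_ker subn_eq0 -ltnNge ltnS.
  exact: rank_leq_col.
pose v := \sum_(i < n.+1) u 0 i *: g i.
have [y vy] : exists y, v = P y.
  have /choice[y yP] : forall i : 'I_n.+1, exists y, P y = g i.
    by move=> i; have [y _ yi] := BP _ (gB i (ltn_ord i)); exists y.
  exists (\sum_(i < n.+1) u 0 i *: y i).
  by rewrite linear_sum; apply: eq_bigr => i _; rewrite linearZ/= yP.
have v0 : v = 0.
  rewrite vy; apply: Pinj => j jn; rewrite -vy.
  rewrite linear_sum linear_sumlz.
  transitivity ((u *m A) 0 (Ordinal jn)); last by rewrite uA mxE.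
  rewrite mxE; apply: eq_bigr => i _.
  by rewrite linearZ/= linearZl_LR/= mxE.
case/negP: u0; apply/eqP/rowP => j; rewrite mxE.
by rewrite -(inner_combination (fun i => u 0 i) j gorth) -/v v0 linear0l.
Qed.

Lemma card_orthonormal_le (B : set H) (C : set H') :
  orthonormal_set B -> B `<=` range P -> (forall c, C c -> sqnorm c = 1) ->
  (forall x, (forall c, C c -> inner (L (P x)) c = 0) -> P x = 0) -> B #<= C.
Proof.
move=> Bon BP C1 Pinj; have [Cfin|Cinf] := pselect (finite_set C); last first.
  apply: (card_le_countable_cover Cinf
    (S := fun c => [set b | B b /\ inner (L b) c != 0])).
    by move=> c /C1; exact: orthonormal_countable_support.
  move=> b Bb; apply: contrapT => Nb; have [x _ xb] := BP _ Bb.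
  have b0 : b = 0.
    rewrite -xb; apply: Pinj => c Cc; rewrite xb; apply: contrapT => /eqP Lb.
    by apply: Nb; exists c.
  have [B1 _] := Bon; have := B1 _ Bb.
  by rewrite b0 linear0l => /eqP; rewrite eq_sym oner_eq0.
have /finite_setP[n Cn] := Cfin.
have [c cC] : exists c : nat -> H', C `<=` c @` `I_n.
  move: Cn; rewrite card_eq_sym => /pcard_eqP/bijPex[c cbij]; exists c.
  by have [_ _] := cbij.
have NB : ~ (`I_(n.+1) #<= B).
  apply: (@orthonormal_finite_le B n c Bon BP) => x cx; apply: Pinj => d /cC[j jn <-].
  exact: cx.
have Bfin : finite_set B.
  apply: contrapT => /infiniteP; move/(card_le_trans (card_leT `I_(n.+1))).
  exact: NB.
have /finite_setP[m Bm] := Bfin; rewrite (card_le_eql Bm) (card_le_eqr Cn) card_le_II.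
by rewrite leqNgt; apply/negP => nm; apply: NB; rewrite (card_le_eqr Bm) card_le_II.
Qed.

End OrthonormalSets.

(** * Spectral calculus *)

Section ProjectionValuedMeasures.
Variables (R : realType) (H : hilbertType R) (E : set R -> {linear H -> H}).
Hypothesis hE : projection_valued_measure E.

Lemma borel_half_lineI (S : set R) : measurable S -> borel_half_line (S `&` @half_line R).
Proof. by move=> mS; split=> [|t []//]; apply: measurableI => //; exact: measurable_itv. Qed.

Lemma borel_half_line0 : borel_half_line (@set0 R).
Proof. by split. Qed.

Lemma pvm_sym S x y : borel_half_line S -> re_inner (E S x) y = re_inner x (E S y).
Proof. by move=> /(pvm_projection hE)[_ Eadj]; rewrite /re_inner Eadj. Qed.

Lemma pvm_idem S x : borel_half_line S -> E S (E S x) = E S x.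
Proof. by move=> /(pvm_projection hE)[+ _]; apply. Qed.

Lemma pvm_sqnorm S x : borel_half_line S -> re_inner (E S x) x = sqnorm (E S x).
Proof. by move=> bS; rewrite /sqnorm -pvm_sym// pvm_idem. Qed.

Lemma pvm_sqnorm_le S x : borel_half_line S -> sqnorm (E S x) <= sqnorm x.
Proof.
move=> bS; have := sqnorm_ge0 (x - E S x).
rewrite sqnormD re_innerNr re_innerC pvm_sqnorm//.
by rewrite {2}/sqnorm re_innerNl re_innerNr opprK -/(sqnorm _); lra.
Qed.

Lemma pvm_disjoint S S' x : borel_half_line S -> borel_half_line S' ->
  S `&` S' = set0 -> E S (E S' x) = 0.
Proof. by move=> bS bS' SS'; rewrite -(pvm_setI hE)// SS' (pvm_set0 hE). Qed.

Lemma pvm_range_subset S S' x : borel_half_line S -> borel_half_line S' ->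
  S `<=` S' -> E S x = x -> E S' x = x.
Proof.
by move=> bS bS' SS' Ex; rewrite -[in LHS]Ex -(pvm_setI hE)// (setIidr SS').
Qed.

Lemma pvm_comm S S' x : borel_half_line S -> borel_half_line S' ->
  E S (E S' x) = E S' (E S x).
Proof. by move=> bS bS'; rewrite -!(pvm_setI hE)// setIC. Qed.

(** Countable additivity for the sequence [S, S', set0, set0, ...], whose partial sums are constant
    from index 2 on. *)
Lemma pvm_setU S S' x : borel_half_line S -> borel_half_line S' ->
  S `&` S' = set0 -> E (S `|` S') x = E S x + E S' x.
Proof.
move=> bS bS' SS'.
have bF n : borel_half_line (bigcup2 S S' n).
  by case: n => [|[|n]] //=; exact: borel_half_line0.
have tF : trivIset setT (bigcup2 S S').
  by apply/trivIsetP => -[|[|i]] [|[|j]] //= _ _ _; rewrite ?setI0 ?set0I// setIC.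
have := @pvm_sigma_additive _ _ _ hE _ bF tF x; rewrite bigcup2E.
move=> Ecvg; rewrite -(cvg_lim (@norm_hausdorff _ _) Ecvg); apply: cvg_lim.
  exact: norm_hausdorff.
apply: cvg_near_cst; exists 2 => // n /= n2.
rewrite /series /= (@big_cat_nat _ _ _ 2)//= big_nat_recr//= big_nat1.
by rewrite big_nat_cond big1 ?addr0// => -[|[|i]]//= _; rewrite (pvm_set0 hE).
Qed.

(** Since [<E(S) x, x> = |E(S) x|^2], this is strong convergence paired with [x]. *)
Lemma pvm_sqnorm_cvg (F : (set R)^nat) x : (forall n, borel_half_line (F n)) ->
  trivIset setT F ->
  (fun n => \sum_(0 <= i < n) sqnorm (E (F i) x)) @ \oo --> sqnorm (E (\bigcup_n F n) x).
Proof.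
move=> bF tF.
have bU : borel_half_line (\bigcup_n F n).
  split; first by apply: bigcup_measurable => n _; have [] := bF n.
  by move=> t [n _]; have [_] := bF n; apply.
rewrite -pvm_sqnorm//.
under eq_fun do under eq_bigr do rewrite -pvm_sqnorm//.
have -> : (fun n => \sum_(0 <= i < n) re_inner (E (F i) x) x) =
    (fun n => re_inner (series (fun i => E (F i) x) n) x).
  apply/funext => n; rewrite /series /=; elim/big_ind2 : _ => //.
    by rewrite re_inner0l.
  by move=> a b c d Hb Hd; rewrite re_innerDl -?Hb -?Hd.
apply/cvgrPdist_lt => e e0.
have Ecvg := @pvm_sigma_additive _ _ _ hE _ bF tF x.
(* With this [d], Cauchy-Schwarz bounds the squared error by [d^2 |x|^2], which is below [e^2]; the
   added 1 keeps the denominator positive. *)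
pose d : R := e / (sqnorm x + 1).
have d0 : 0 < d by rewrite divr_gt0// ltr_wpDl// sqnorm_ge0.
move/cvgrPdist_lt : Ecvg => /(_ d%:C%C); rewrite ltcR => /(_ d0).
apply: filterS => n /= dist_lt.
set y := E _ x - series _ n in dist_lt *.
have -> : re_inner (E (\bigcup_n0 F n0) x) x -
    re_inner (series (fun i => E (F i) x) n) x = re_inner y x.
  by rewrite /y re_innerDl re_innerNl.
have yd : sqnorm y < d ^+ 2.
  by rewrite -ltcR sqnormE rmorphXn/= ltrXn2r ?nnegrE ?normr_ge0// ?lecR ?ltW.
have cs := cauchy_schwarz y x.
have x0 := sqnorm_ge0 x; have y0 := sqnorm_ge0 y.
rewrite -(ltr_pXn2r (n := 2)) ?nnegrE ?normr_ge0 ?ltW//.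
rewrite real_normK ?num_real//.
apply: (le_lt_trans cs).
have -> : e = d * (sqnorm x + 1) by rewrite /d divfK// gt_eqF// ltr_wpDl.
rewrite exprMn; nra.
Qed.

(* The scalar measure, reset to 0 on nonmeasurable sets: there it is a junk value
   that may be negative, whereas measures are nonnegative on every set. The proof
   argument lets the measure instance below be inferred. *)
Definition spectral_mass (_ : projection_valued_measure E) (x : H) (S : set R) : \bar R :=
  if `[< measurable S >] then scalar_measure E x S else 0%E.

Lemma spectral_massE x S : measurable S ->
  spectral_mass hE x S = (sqnorm (E (S `&` @half_line R) x))%:E.
Proof.
move=> mS; rewrite /spectral_mass asboolT// /scalar_measure -pvm_sqnorm//.
exact: borel_half_lineI.
Qed.

Lemma spectral_mass0 x : spectral_mass hE x set0 = 0%E.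
Proof. by rewrite spectral_massE// set0I (pvm_set0 hE) /sqnorm re_inner0l. Qed.

Lemma spectral_mass_ge0 x S : (0 <= spectral_mass hE x S)%E.
Proof.
have [mS|NmS] := pselect (measurable S); last by rewrite /spectral_mass asboolF.
by rewrite spectral_massE// lee_fin sqnorm_ge0.
Qed.

Lemma spectral_mass_sigma_additive x : semi_sigma_additive (spectral_mass hE x).
Proof.
move=> F mF tF mUF; rewrite spectral_massE// setI_bigcupl.
have -> : (fun n => \sum_(0 <= i < n) spectral_mass hE x (F i))%E =
    (fun n => (\sum_(0 <= i < n) sqnorm (E (F i `&` @half_line R) x))%:E).
  by apply/funext => n; rewrite -sumEFin; apply: eq_bigr => i _; rewrite spectral_massE.
apply: cvg_EFin; first exact: nearW.
apply: pvm_sqnorm_cvg; first by move=> n; exact: borel_half_lineI.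
exact: trivIset_setIr.
Qed.

End ProjectionValuedMeasures.

HB.instance Definition _ R H E hE x := isMeasure.Build _ _ _ (@spectral_mass R H E hE x)
  (spectral_mass0 hE x) (spectral_mass_ge0 hE x) (@spectral_mass_sigma_additive R H E hE x).

(** * Quadratic form bounds from the spectral integral *)

Section SpectralIntegral.
Variables (R : realType) (H : hilbertType R) (E : set R -> {linear H -> H}).
Variable A : {linear H -> H}.
Hypothesis hE : projection_valued_measure E.
Hypothesis hA : is_spectral_integral E A.
Local Open Scope ereal_scope.

Import HBNNSimple.

(** Integrals are built from simple functions, whose level sets are measurable, and there both set
    functions agree. *)
Lemma integral_spectral_mass x (D : set R) (f : R -> \bar R) :
  \int[scalar_measure E x]_(l in D) f l = \int[spectral_mass hE x]_(l in D) f l.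
Proof.
have sE (h : {nnsfun R >-> R}) :
    sintegral (scalar_measure E x) h = sintegral (spectral_mass hE x) h.
  rewrite /sintegral; apply: eq_fsbigr => r _; congr (_ * _).
  by rewrite /spectral_mass asboolT//; exact: measurable_sfunP.
rewrite /integral; congr (ereal_sup _ - ereal_sup _).
  by apply/seteqP; split=> _ [h hf <-]; exists h.
by apply/seteqP; split=> _ [h hf <-]; exists h.
Qed.

Lemma measurable_half_line : measurable (@half_line R).
Proof. exact: measurable_itv. Qed.
Local Hint Resolve measurable_half_line : core.

Lemma half_line_ge0 (l : R) : half_line l -> 0 <= l%:E.
Proof. by rewrite /half_line /= in_itv/= andbT lee_fin. Qed.

Lemma spectral_integral x : \int[spectral_mass hE x]_(l in @half_line R) l%:E =
  (re_inner (A x) x)%:E.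
Proof.
have [/integrableP[_]] := hA x.
rewrite /re_inner => + ->; rewrite !integral_spectral_mass /=.
rewrite [X in X < _](eq_integral (fun l : R => l%:E)); last first.
  by move=> l /set_mem/half_line_ge0 l0 /=; rewrite ger0_norm -?lee_fin.
move=> Ioo; rewrite fineK// ge0_fin_numE//.
by apply: integral_ge0 => l /half_line_ge0.
Qed.

(** [N] has mass [|E(N) x|^2 = 0]. This localizes the integral to an interval whose spectral
    subspace contains [x]. *)
Lemma spectral_integral_negligible x (N : set R) : measurable N ->
  E (N `&` @half_line R) x = 0%R ->
  \int[spectral_mass hE x]_(l in @half_line R `\` N) l%:E = (re_inner (A x) x)%:E.
Proof.
move=> mN EN; rewrite -spectral_integral [RHS](@ge0_negligible_integral _ _ _ _ _ N)//.
- by move=> l /half_line_ge0.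
- by apply: (etrans (spectral_massE hE x mN)); rewrite EN /sqnorm re_inner0l.
Qed.

Lemma spectral_le (mu : R) x : (0 <= mu)%R -> E `[0%R, mu]%classic x = x ->
  (re_inner (A x) x <= mu * sqnorm x)%R.
Proof.
move=> mu0 Ex; have Dh : `[0%R, mu]%classic `<=` @half_line R.
  by move=> l /=; rewrite /half_line/= !in_itv/= andbT => /andP[].
have DE : @half_line R `\` `]mu, +oo[%classic = `[0%R, mu]%classic.
  apply/seteqP; split=> l /=; rewrite /half_line/= !in_itv/= !andbT.
    by move=> [-> /negP]; rewrite -leNgt.
  by move=> /andP[-> lmu]; split=> //; apply/negP; rewrite -leNgt.
rewrite -lee_fin -(@spectral_integral_negligible x `]mu, +oo[%classic)//; last first.
  rewrite -Ex pvm_disjoint//.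
  - exact: borel_half_lineI.
  - rewrite -subset0 => l /= []; rewrite /half_line/= !in_itv/= => -[+ _] /andP[_].
    by rewrite andbT ltNge => /negP.
rewrite DE EFinM.
apply: (@le_trans _ _ (\int[spectral_mass hE x]_(l in `[0%R, mu]%classic) mu%:E)).
  apply: ge0_le_integral => //=.
  - by move=> l /Dh/half_line_ge0.
  - by move=> l; rewrite in_itv/= => /andP[_]; rewrite lee_fin.
by rewrite (integral_cst (spectral_mass hE x))//= spectral_massE// (setIidl Dh) Ex.
Qed.

(** The mass of [x] lives on [D], where [l - mu > 0]. The assumed bound makes the integral of
    [l - mu] over [D] nonpositive, so [D] is null; but its mass is [|x|^2]. *)
Lemma spectral_gt (mu : R) x : (0 <= mu)%R -> E `]mu, +oo[%classic x = x ->
  (re_inner (A x) x <= mu * sqnorm x)%R -> x = 0%R.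
Proof.
move=> mu0 Ex; set D := `]mu, +oo[%classic in Ex *.
have Dh : D `<=` @half_line R.
  move=> l /=; rewrite /D /half_line/= !in_itv/= !andbT => hlt.
  by rewrite (le_trans mu0)// ltW.
have mD : measurable D by exact: measurable_itv.
have DE : @half_line R `\` `[0%R, mu]%classic = D.
  apply/seteqP; split=> l /=; rewrite /D /half_line/= !in_itv/= !andbT.
    by move=> [->] /= /negP; rewrite -ltNge.
  move=> hlt; split; first exact: le_trans (ltW hlt).
  by apply/negP; rewrite negb_and -!ltNge hlt orbT.
rewrite -lee_fin -(@spectral_integral_negligible x `[0%R, mu]%classic)//; last first.
  rewrite -Ex pvm_disjoint//.
  - exact: borel_half_lineI.
  - rewrite -subset0 => l /= []; rewrite /D /half_line/= !in_itv/= => -[/andP[_ + _]].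
    by rewrite andbT leNgt => /negP.
have mx : spectral_mass hE x D = (sqnorm x)%:E.
  by rewrite spectral_massE// (setIidl Dh) Ex.
have gtD l : D l -> (mu < l)%R by rewrite /D /= in_itv/= andbT.
have mf (f : R -> R) : measurable_fun setT f -> measurable_fun D (EFin \o f).
  by move=> mf; apply/measurable_EFinP; exact: measurable_funTS.
have msub : measurable_fun D (fun l : R => (l - mu)%:E).
  by apply: (mf (fun l => l - mu)%R); exact: measurable_funB.
have -> : \int[spectral_mass hE x]_(l in @half_line R `\` `[0%R, mu]%classic) l%:E =
    \int[spectral_mass hE x]_(l in D) (mu%:E + (l - mu)%:E).
  by rewrite DE; apply: eq_integral => l _; rewrite -EFinD addrC subrK.
rewrite ge0_integralD//=; last first.
  by move=> l /gtD hlt; rewrite lee_fin subr_ge0 ltW.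
rewrite (integral_cst (spectral_mass hE x))//= mx -EFinM -[leRHS]adde0 leeD2lE// => I0.
have : \int[spectral_mass hE x]_(l in D) `|(l - mu)%:E| = 0.
  rewrite (eq_integral (fun l : R => (l - mu)%:E)); last first.
    by move=> l /set_mem/gtD hlt; rewrite gee0_abs// lee_fin subr_ge0 ltW.
  apply/eqP; rewrite eq_le I0 integral_ge0// => l /gtD hlt.
  by rewrite lee_fin subr_ge0 ltW.
move=> /(ae_eq_integral_abs _ mD msub) ae0.
have /(measure_negligible mD) : (spectral_mass hE x).-negligible D.
  apply: negligibleS ae0 => l Dl /= /(_ Dl) [] /eqP.
  by rewrite subr_eq0 gt_eqF// gtD.
by move=> m0; have [/sqnorm_eq0] := etrans (esym mx) m0.
Qed.

(** [E B x] and [E B y] stay in the orthogonal ranges of [E S] and [E S'], so by Pythagoras the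
    scalar measure of [x + y] is the sum of those of [x] and [y]. *)
Lemma spectral_additive (S S' : set R) x y :
  borel_half_line S -> borel_half_line S' -> S `&` S' = set0 ->
  E S x = x -> E S' y = y ->
  re_inner (A (x + y)%R) (x + y)%R = (re_inner (A x) x + re_inner (A y) y)%R.
Proof.
move=> bS bS' SS' Ex Ey; apply/eqP; rewrite -eqe; apply/eqP.
rewrite EFinD -!spectral_integral -ge0_integral_measure_add//; first last.
- by move=> l /half_line_ge0.
apply: eq_measure_integral => B mB _.
apply: (etrans (spectral_massE hE (x + y)%R mB)); apply/esym.
apply: (etrans (measure_addE _ _ _)).
apply: (etrans (f_equal2 _ (spectral_massE hE x mB) (spectral_massE hE y mB))).
rewrite -EFinD; congr EFin; rewrite linearD; have bB := borel_half_lineI mB.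
have -> : E (B `&` @half_line R) x = E S (E (B `&` @half_line R) x).
  by rewrite pvm_comm// Ex.
have -> : E (B `&` @half_line R) y = E S' (E (B `&` @half_line R) y).
  by rewrite pvm_comm// Ey.
by rewrite sqnormD (pvm_sym hE _ _ bS) (pvm_disjoint hE _ bS bS' SS')
  (re_innerC _ 0%R) re_inner0l mulr0 addr0.
Qed.

End SpectralIntegral.

(** * Commutation and norm bounds for a positive operator *)

Section PositiveOperator.
Variables (R : realType) (H : hilbertType R) (E : set R -> {linear H -> H}).
Variable A : {linear H -> H}.
Hypothesis hE : projection_valued_measure E.
Hypothesis hA : is_spectral_integral E A.
Hypothesis Apos : positive_semidefinite A.

Lemma psd_im0 x : complex.Im (inner (A x) x) = 0.
Proof. by have := Apos x; rewrite lecE /= => /andP[/eqP ->]. Qed.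

(* Positivity makes <A z, z> real for z = x, y and x + i y. *)
Lemma psd_sym x y : re_inner (A x) y = re_inner x (A y).
Proof.
rewrite (re_innerC x).
have := psd_im0 (x + 'i%C *: y); rewrite /re_inner.
have -> : A (x + 'i%C *: y) = A x + 'i%C *: A y by rewrite linearD linearZ.
have -> : inner (A x + 'i%C *: A y) (x + 'i%C *: y) = inner (A x) x +
    Num.conj 'i%C * inner (A x) y + 'i%C * (inner (A y) x + Num.conj 'i%C * inner (A y) y).
  by rewrite linearDl linearZl_LR/= !linearDr/= !linearZr_LR.
have := psd_im0 x; have := psd_im0 y.
case: (inner (A x) x) => a b; case: (inner (A y) y) => c d /=.
case: (inner (A x) y) => e f; case: (inner (A y) x) => g h /= -> ->.
lra.
Qed.

(* <A(x + y), x + y> = <A x, x> + <A y, y> for y := E S' (A x), since the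
   scalar measures add up; by symmetry the cross term <A x, y> = |y|^2 is 0. *)
Lemma psd_orthogonal (S S' : set R) x :
  borel_half_line S -> borel_half_line S' -> S `&` S' = set0 ->
  E S x = x -> E S' (A x) = 0.
Proof.
move=> bS bS' SS' Ex; apply: sqnorm_eq0.
set y := E S' (A x).
have := spectral_additive hE hA bS bS' SS' Ex (pvm_idem hE (A x) bS').
rewrite -/y linearD !re_innerDl !re_innerDr (psd_sym y x) (re_innerC (A x) y).
have -> : re_inner y (A x) = sqnorm y by exact: pvm_sqnorm.
lra.
Qed.

(** By orthogonality [A] preserves the ranges of [E S] and of its complement [E S']; decompose [x]
    along the two. *)
Lemma psd_comm (S : set R) x : borel_half_line S -> E S (A x) = A (E S x).
Proof.
move=> bS; pose S' := @half_line R `\` S.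
have bS' : borel_half_line S'.
  by split=> [|l []//]; apply: measurableD; [exact: measurable_itv|case: bS].
have SS' : S `&` S' = set0 by exact: setDIK.
have split z : z = E S z + E S' z.
  by rewrite -pvm_setU// setDUK ?(pvm_half_line hE)//; case: bS.
rewrite [in LHS](split x) [RHS]split !linearD.
have S'S : S' `&` S = set0 by rewrite setIC.
rewrite (psd_orthogonal bS' bS S'S (pvm_idem hE x bS')).
by rewrite (psd_orthogonal bS bS' SS' (pvm_idem hE x bS)).
Qed.

Lemma psd_sqnorm_le (mu : R) x : 0 <= mu -> E `[0, mu]%classic x = x ->
  sqnorm (A x) <= mu ^+ 2 * sqnorm x.
Proof.
move=> mu0 Ex; have bI : borel_half_line `[0, mu]%classic.
  by split=> [|l]; [exact: measurable_itv|rewrite /half_line/= !in_itv/= andbT => /andP[]].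
have q1 := spectral_le hE hA mu0 Ex.
have q2 : re_inner (A (A x)) (A x) <= mu * sqnorm (A x).
  by apply: (spectral_le hE hA mu0); rewrite psd_comm// Ex.
(* Positivity at t x - A x replaces Cauchy-Schwarz for the form <A x, y>. *)
have h t : 0 <= t ^+ 2 * re_inner (A x) x - 2 * t * sqnorm (A x) + re_inner (A (A x)) (A x).
  have : 0 <= re_inner (A (t%:C%C *: x - A x)) (t%:C%C *: x - A x).
    by have := Apos (t%:C%C *: x - A x); rewrite lecE => /andP[_].
  have -> : A (t%:C%C *: x - A x) = t%:C%C *: A x - A (A x) by rewrite linearB linearZ.
  rewrite !re_innerDl !re_innerDr !re_innerNl !re_innerNr !re_innerZl !re_innerZr.
  rewrite (psd_sym (A x) x) -/(sqnorm _); lra.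
(* For [mu > 0], taking [t = mu] yields [mu |A x|^2 <= mu^3 |x|^2]. For [mu = 0] there is nothing to
   divide by; both forms are then nonpositive and [t = 1] forces [A x = 0]. *)
have [mu_eq0|mu_neq0] := eqVneq mu 0; last first.
  have mup : 0 < mu by rewrite lt_def mu_neq0.
  by rewrite -(ler_pM2l mup); have := h mu; nra.
by have := h 1; move: q1 q2; rewrite mu_eq0; lra.
Qed.

Lemma psd_sqnorm_gt (mu : R) x : 0 <= mu -> E `]mu, +oo[%classic x = x ->
  sqnorm (A x) <= mu ^+ 2 * sqnorm x -> x = 0.
Proof.
move=> mu0 Ex Ax; apply: (spectral_gt hE hA mu0 Ex).
have [mu_eq0|mu_neq0] := eqVneq mu 0.
  move: Ax; rewrite mu_eq0 expr0n/= !mul0r => Ax.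
  have /sqnorm_eq0 -> : sqnorm (A x) = 0 by apply/eqP; rewrite eq_le Ax sqnorm_ge0.
  by rewrite re_inner0l.
have mup : 0 < mu by rewrite lt_def mu_neq0.
(* [|A x - mu x|^2 >= 0] gives [2 mu <A x, x> <= |A x|^2 + mu^2 |x|^2 <= 2 mu^2 |x|^2]. *)
rewrite -(ler_pM2l mup); have := sqnorm_ge0 (A x + (- mu)%:C%C *: x).
rewrite sqnormD sqnormZ re_innerZr; lra.
Qed.

End PositiveOperator.

(** * Transfer from the square root to the operator itself *)

Section AbsSpectralMeasure.
Variables (R : realType) (H H' : hilbertType R) (T : {linear H -> H'}).
Variable E : set R -> {linear H -> H}.
Hypothesis hT : abs_spectral_measure T E.

Lemma abs_spectral_pvm : projection_valued_measure E.
Proof. by have [A [_ []]] := hT. Qed.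

Lemma abs_spectral_sqnorm : exists A : {linear H -> H},
  [/\ is_spectral_integral E A, positive_semidefinite A &
      forall x, sqnorm (T x) = sqnorm (A x)].
Proof.
have [A [[_ Apos [Ts [_ adj AA]]] [_ hA]]] := hT.
exists A; split=> // x.
rewrite /sqnorm /re_inner adj -AA.
exact/esym/(psd_sym Apos).
Qed.

Lemma abs_spectral_le (mu : R) x : 0 <= mu -> E `[0, mu]%classic x = x ->
  sqnorm (T x) <= mu ^+ 2 * sqnorm x.
Proof.
have [A [hA Apos ->]] := abs_spectral_sqnorm.
exact: (psd_sqnorm_le abs_spectral_pvm hA Apos).
Qed.

Lemma abs_spectral_gt (mu : R) x : 0 <= mu -> E `]mu, +oo[%classic x = x ->
  sqnorm (T x) <= mu ^+ 2 * sqnorm x -> x = 0.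
Proof.
have [A [hA Apos ->]] := abs_spectral_sqnorm.
exact: (psd_sqnorm_gt abs_spectral_pvm hA).
Qed.

Lemma abs_spectral_ge (mu : R) x : 0 <= mu -> E `]mu, +oo[%classic x = x ->
  mu ^+ 2 * sqnorm x <= sqnorm (T x).
Proof.
move=> mu0 Ex; rewrite leNgt; apply/negP => Tx.
by move: (Tx); rewrite (abs_spectral_gt mu0 Ex (ltW Tx)) linear0 /sqnorm
  !re_inner0l mulr0 ltxx.
Qed.

(** [|T x| = |A x|], and [A] commutes with the contraction [E S]. *)
Lemma abs_spectral_proj (S : set R) x : borel_half_line S ->
  sqnorm (T (E S x)) <= sqnorm (T x).
Proof.
have [A [hA Apos TA]] := abs_spectral_sqnorm => bS; rewrite !TA.
by rewrite -(psd_comm abs_spectral_pvm hA Apos)// pvm_sqnorm_le//; exact: abs_spectral_pvm.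
Qed.

End AbsSpectralMeasure.

(** * Comparison of the dimension measures *)

(** Otherwise [y], normalized, could be added to [B], against maximality. *)
Lemma orthonormal_basis_total (R : realType) (H : hilbertType R) (V B : set H) (y : H) :
  (forall a x, V x -> V (a *: x)) -> orthonormal_basis V B -> V y ->
  (forall b, B b -> inner y b = 0) -> y = 0.
Proof.
move=> VZ [[B1 B0] BV Bmax] Vy yB; apply: contrapT => y0.
have yp : 0 < sqnorm y.
  by rewrite lt_def sqnorm_ge0 andbT; apply/eqP => /sqnorm_eq0.
pose z := ((Num.sqrt (sqnorm y))^-1)%:C%C *: y.
have zz : inner z z = 1.
  by rewrite inner_sqnorm sqnormZ exprVn sqr_sqrtr ?sqnorm_ge0// mulVf ?gt_eqF.
have zB b : B b -> inner z b = 0.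
  by move=> /yB yb; rewrite /z linearZl_LR/= yb mulr0.
have Bz b : B b -> inner b z = 0 by move=> /zB zb; rewrite innerC zb conjC0.
have /seteqP[zinB _] : B `|` [set z] = B.
  apply: Bmax; last by move=> b; left.
  - split=> [b [/B1//|->//]|b c [Bb|->] [Bc|->]].
    + exact: B0.
    + by move=> _; exact: Bz.
    + by move=> _; exact: zB.
    + by [].
  - by move=> b [/BV//|->]; exact: VZ.
have Bz' : B z by apply: zinB; right.
by move: zz; rewrite zB// => /eqP; rewrite eq_sym oner_eq0.
Qed.

Section Comparison.
Variables (R : realType) (H1 H1' H2 H2' : hilbertType R).
Variables (T1 : {linear H1 -> H1'}) (T2 : {linear H2 -> H2'}).
Variables (E1 : set R -> {linear H1 -> H1}) (E2 : set R -> {linear H2 -> H2}).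
Hypotheses (hT1 : abs_spectral_measure T1 E1) (hT2 : abs_spectral_measure T2 E2).
Variables (U : {linear H1 -> H2}) (Uinv : {linear H2 -> H1}).
Variables (V : {linear H1' -> H2'}) (Vinv : {linear H2' -> H1'}).
Variable k : R.
Hypotheses (k1 : 1 <= k) (UK : cancel U Uinv).
Hypotheses (Uk : forall x, sqnorm (U x) <= k * sqnorm x)
  (Uinvk : forall x, sqnorm (Uinv x) <= k * sqnorm x)
  (Vk : forall x, sqnorm (V x) <= k * sqnorm x)
  (Vinvk : forall x, sqnorm (Vinv x) <= k * sqnorm x).
Hypotheses (T2U : forall x, T2 (U x) = V (T1 x))
  (T1Uinv : forall y, T1 (Uinv y) = Vinv (T2 y)).

Let hE1 := abs_spectral_pvm hT1.
Let hE2 := abs_spectral_pvm hT2.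
Let k0 : 0 <= k. Proof. exact: le_trans k1. Qed.
Let kp : 0 < k. Proof. exact: lt_le_trans k1. Qed.

Lemma dim_measure_le (S S' : set R) : borel_half_line S -> borel_half_line S' ->
  (forall x, E1 S x = x -> E2 S' (U x) = 0 -> x = 0) ->
  dim_measure E1 S #<= dim_measure E2 S'.
Proof.
move=> bS bS' inj; have [B_on BV _] := hilbert_dimP (range (E1 S)).
have C_basis := hilbert_dimP (range (E2 S')); have [[C1 C0] CV _] := C_basis.
apply: (@card_orthonormal_le _ _ _ (E2 S' \o U) k k0 _ (E1 S)) => //.
- move=> x /=; exact: le_trans (pvm_sqnorm_le hE2 _ bS') (Uk x).
- by move=> c Cc; rewrite /sqnorm /re_inner C1.
move=> x xC; apply: inj; first exact: pvm_idem.
apply: (orthonormal_basis_total _ C_basis) => //.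
by move=> a _ [y _ <-]; exists (a *: y) => //; rewrite linearZ.
Qed.

Let borel_cc (a b : R) : 0 <= a -> borel_half_line `[a, b]%classic.
Proof.
move=> a0; split=> [|l]; first exact: measurable_itv.
by rewrite /half_line/= !in_itv/= andbT => /andP[/(le_trans a0)].
Qed.

Let borel_oc (a b : R) : 0 <= a -> borel_half_line `]a, b]%classic.
Proof.
move=> a0; split=> [|l]; first exact: measurable_itv.
by rewrite /half_line/= !in_itv/= andbT => /andP[/(le_lt_trans a0)/ltW].
Qed.

Let borel_oy (a : R) : 0 <= a -> borel_half_line `]a, +oo[%classic.
Proof.
move=> a0; split=> [|l]; first exact: measurable_itv.
by rewrite /half_line/= !in_itv/= !andbT => /(le_lt_trans a0)/ltW.
Qed.

Lemma pvm_split_half_line (H : hilbertType R) (E : set R -> {linear H -> H}) (a : R) x :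
  projection_valued_measure E -> 0 <= a ->
  x = E `[0, a]%classic x + E `]a, +oo[%classic x.
Proof.
move=> hE a0; rewrite -pvm_setU//; [|exact: borel_cc|exact: borel_oy|].
  rewrite (_ : _ `|` _ = @half_line R) ?(pvm_half_line hE)//.
  apply/seteqP; split=> l; rewrite /half_line/= !in_itv/= !andbT.
    by move=> [/andP[]//|/(le_lt_trans a0)/ltW].
  by move=> ->; case: (leP l a) => ?; [left|right].
rewrite -subset0 => l /= []; rewrite !in_itv/= andbT => /andP[_].
by rewrite leNgt => /negP.
Qed.

Lemma pvm_split_itv (H : hilbertType R) (E : set R -> {linear H -> H}) (a b : R) x :
  projection_valued_measure E -> 0 <= a -> a <= b ->
  E `[0, b]%classic x = E `[0, a]%classic x + E `]a, b]%classic x.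
Proof.
move=> hE a0 ab; rewrite -pvm_setU//; [|exact: borel_cc|exact: borel_oc|].
  congr (E _ x); apply/seteqP; split=> l /=; rewrite !in_itv/=.
    by move=> /andP[-> ->]; rewrite andbT; case: (leP l a) => ?; [left|right].
  move=> [/andP[-> la]|/andP[al ->]]; first by rewrite (le_trans la ab).
  by rewrite andbT (ltW (le_lt_trans a0 al)).
rewrite -subset0 => l /= []; rewrite !in_itv/= => /andP[_ la] /andP[].
by rewrite ltNge la.
Qed.

Lemma dim_measure_le_cc (mu : R) : 0 <= mu ->
  dim_measure E1 `[0, mu]%classic #<= dim_measure E2 `[0, 4 * k * mu]%classic.
Proof.
move=> mu0; have Kmu0 : 0 <= 4 * k * mu by rewrite !mulr_ge0.
apply: dim_measure_le; [exact: borel_cc|exact: borel_cc|move=> x Ex EUx].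
rewrite -[LHS]UK; suff -> : U x = 0 by rewrite linear0.
apply: (abs_spectral_gt hT2 Kmu0).
  by rewrite [RHS](pvm_split_half_line _ hE2 Kmu0) EUx add0r.
have xUx : sqnorm x <= k * sqnorm (U x) by rewrite -{1}(UK x).
rewrite T2U; apply: (le_trans (Vk _)).
apply: (le_trans (ler_wpM2l k0 (abs_spectral_le hT1 mu0 Ex))).
apply: (@le_trans _ _ (k * (mu ^+ 2 * (k * sqnorm (U x))))).
  by rewrite ler_wpM2l// ler_wpM2l// sqr_ge0.
have : 0 <= (k * mu) ^+ 2 * sqnorm (U x) by rewrite mulr_ge0// ?sqr_ge0// sqnorm_ge0.
lra.
Qed.

(** The factor 4 in [K = 4 k] makes [E1 S (Uinv g)] and [E1 S (Uinv b)] have squared norm at most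
    [|z|^2 / 16] each. Their sum is [z], so [|z|^2 <= 2 (1/16 + 1/16) |z|^2 = |z|^2 / 4]. *)
Lemma dim_measure_le_oc (mu' mu : R) : 0 <= mu' -> mu' < mu ->
  dim_measure E1 `]mu', mu]%classic #<=
  dim_measure E2 `]mu' / (4 * k), 4 * k * mu]%classic.
Proof.
move=> mu'0 mu'mu; have mu0 : 0 < mu by exact: le_lt_trans mu'mu.
set K := 4 * k; have Kp : 0 < K by rewrite mulr_gt0.
have Kmu0 : 0 <= K * mu by rewrite mulr_ge0 ?ltW.
have mu'K0 : 0 <= mu' / K by rewrite divr_ge0// ltW.
apply: dim_measure_le; [exact: borel_oc|exact: borel_oc|move=> z Ez EUz].
have mu'Kmu : mu' / K <= K * mu.
  rewrite ler_pdivrMr//; apply: (le_trans (ltW mu'mu)).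
  have K1 : 1 <= K by rewrite /K; move: k1; lra.
  by rewrite mulrAC ler_peMl ?(ltW mu0)// mulr_ege1.
set S := `]mu', mu]%classic in Ez *.
have bS : borel_half_line S by exact: borel_oc.
pose g := E2 `[0, mu' / K]%classic (U z).
pose b := E2 `]K * mu, +oo[%classic (U z).
have Uzgb : U z = g + b.
  rewrite [LHS](pvm_split_half_line _ hE2 Kmu0) (pvm_split_itv _ hE2 mu'K0 mu'Kmu).
  by rewrite EUz addr0.
have z0 := sqnorm_ge0 z.
have Tz : sqnorm (T1 z) <= mu ^+ 2 * sqnorm z.
  apply: (abs_spectral_le hT1 (ltW mu0)); apply: (pvm_range_subset hE1 bS _ _ Ez).
    exact: borel_cc.
  by move=> l; rewrite /S/= !in_itv/= => /andP[/(le_lt_trans mu'0)/ltW -> ->].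
(* [T2] is at least [K mu] on [b], while [|T2 b|^2 <= |T2 (U z)|^2 <= k mu^2 |z|^2]; divide by
   [k mu^2]. *)
have b_le : 16 * k * sqnorm b <= sqnorm z.
  have : (K * mu) ^+ 2 * sqnorm b <= k * (mu ^+ 2 * sqnorm z).
    apply: (le_trans (abs_spectral_ge hT2 Kmu0 (pvm_idem hE2 _ (borel_oy Kmu0)))).
    apply: (le_trans (abs_spectral_proj hT2 _ (borel_oy Kmu0))).
    by rewrite T2U; apply: (le_trans (Vk _)); rewrite ler_wpM2l.
  have kmu : 0 < k * mu ^+ 2 by rewrite mulr_gt0// exprn_gt0.
  by move=> h; rewrite -(ler_pM2l kmu); move: h; rewrite /K; lra.
have q_le : sqnorm (E1 S (Uinv b)) <= sqnorm z / 16.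
  apply: (le_trans (pvm_sqnorm_le hE1 _ bS)); apply: (le_trans (Uinvk _)); lra.
have p_le : sqnorm (E1 S (Uinv g)) <= sqnorm z / 16.
  have Tp : sqnorm (T1 (E1 S (Uinv g))) <= mu' ^+ 2 * (sqnorm z / 16).
    apply: (le_trans (abs_spectral_proj hT1 _ bS)); rewrite T1Uinv.
    apply: (le_trans (Vinvk _)).
    have Tg : sqnorm (T2 g) <= (mu' / K) ^+ 2 * sqnorm g.
      by apply: (abs_spectral_le hT2 mu'K0); exact: pvm_idem (borel_cc _ _).
    have gz : sqnorm g <= k * sqnorm z.
      exact: le_trans (pvm_sqnorm_le hE2 _ (borel_cc _ _)) (Uk z).
    apply: (@le_trans _ _ (k * ((mu' / K) ^+ 2 * (k * sqnorm z)))).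
      rewrite ler_wpM2l//; apply: (le_trans Tg); rewrite ler_wpM2l//.
      exact: sqr_ge0.
    have -> : k * ((mu' / K) ^+ 2 * (k * sqnorm z)) = mu' ^+ 2 * (sqnorm z / 16).
      by rewrite /K; field; rewrite gt_eqF.
    by [].
  (* [mu'] may be 0, so [Tp] cannot simply be divided by [mu'^2]. If the bound failed,
     [E1 S (Uinv g)] would violate the strict lower bound for [T1] above [mu'] unless it were 0,
     which is absurd too. *)
  rewrite leNgt; apply/negP => lt_p.
  have p0 : E1 S (Uinv g) = 0.
    apply: (abs_spectral_gt hT1 mu'0).
      apply: (pvm_range_subset hE1 bS (borel_oy mu'0) _ (pvm_idem hE1 _ bS)).
      by move=> l; rewrite /S/= !in_itv/= andbT => /andP[].
    by apply: (le_trans Tp); rewrite ler_wpM2l ?sqr_ge0// ltW.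
  by move: lt_p; rewrite p0 /sqnorm re_inner0l -/(sqnorm z); lra.
apply: sqnorm_eq0.
have zpq : z = E1 S (Uinv g) + E1 S (Uinv b).
  by rewrite -linearD -linearD -Uzgb UK.
have := sqnormD_le (E1 S (Uinv g)) (E1 S (Uinv b)); rewrite -zpq; lra.
Qed.

End Comparison.

Theorem theorem8 (R : realType) (H1 H1' H2 H2' : hilbertType R)
  (T1 : {linear H1 -> H1'}) (T2 : {linear H2 -> H2'})
  (hT1 : continuous T1) (hT2 : continuous T2)
  (E1 : set R -> {linear H1 -> H1}) (E2 : set R -> {linear H2 -> H2})
  (hE1 : abs_spectral_measure T1 E1) (hE2 : abs_spectral_measure T2 E2) :
  topologically_equivalent T1 T2 ->
  equivalent_dim_measures (dim_measure E1) (dim_measure E2).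
Proof.
move=> [U [Uinv [V [Vinv [[cU cUinv UK UinvK] [cV cVinv VK VinvK] T2E]]]]].
have [k1 k10 Uk1] := linear_sqnorm_bounded cU.
have [k2 k20 Uk2] := linear_sqnorm_bounded cUinv.
have [k3 k30 Vk3] := linear_sqnorm_bounded cV.
have [k4 k40 Vk4] := linear_sqnorm_bounded cVinv.
(* One constant bounding all four isomorphisms lets the reverse inequalities follow by exchanging
   [T1] with [T2], [U] with [Uinv] and [V] with [Vinv]. *)
pose k := 1 + k1 + k2 + k3 + k4.
have k_ge1 : 1 <= k by rewrite /k; lra.
have bound (H H' : hilbertType R) (W : {linear H -> H'}) c :
    (forall x, sqnorm (W x) <= c * sqnorm x) -> c <= k ->
    forall x, sqnorm (W x) <= k * sqnorm x.
  by move=> Wc ck x; apply: (le_trans (Wc x)); rewrite ler_wpM2r// sqnorm_ge0.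
have Uk := bound _ _ _ _ Uk1 ltac:(rewrite /k; lra).
have Uinvk := bound _ _ _ _ Uk2 ltac:(rewrite /k; lra).
have Vk := bound _ _ _ _ Vk3 ltac:(rewrite /k; lra).
have Vinvk := bound _ _ _ _ Vk4 ltac:(rewrite /k; lra).
have T2U x : T2 (U x) = V (T1 x) by rewrite T2E UK.
have T1Uinv y : T1 (Uinv y) = Vinv (T2 y) by rewrite T2E VK.
exists (4 * k); first lra.
split=> [mu mu0|mu' mu mu'0 mu'mu]; split.
- exact: (dim_measure_le_cc hE1 hE2 k_ge1 UK).
- exact: (dim_measure_le_cc hE2 hE1 k_ge1 UinvK).
- exact: (dim_measure_le_oc hE1 hE2 k_ge1 UK Uk Uinvk Vk Vinvk).
- exact: (dim_measure_le_oc hE2 hE1 k_ge1 UinvK Uinvk Uk Vinvk Vk).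
Qed.
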